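(* Let $R$ be a simple $\Sigma\Delta$-ring and $a_1,\dots,a_m\in R$. Then $a_1,\dots,a_m$ are linearly dependent over $R^{\Sigma\Delta}$ if and only if for any $\theta_1,\dots,\theta_m\in\Theta$ one has $\det\big((\theta_i(a_j))_{1\le i,j\le m}\big)=0$.
   Context: Rings are commutative with $1$. A $\Sigma\Delta$-ring is a ring $R$ with a set $\Sigma$ of automorphisms and a set $\Delta$ of derivations such that $\tau(\mu(r))=\mu(\tau(r))$ for all $\mu,\tau\in\Sigma\cup\Delta$ and $r\in R$. A $\Sigma\Delta$-ideal is an ideal $I$ with $\tau(I)\subseteq I$ for all $\tau\in\Sigma\cup\Delta$; $R$ is simple if it is nonzero and its only $\Sigma\Delta$-ideals are $(0)$ and $R$. The constants are $R^{\Sigma\Delta}=\{r\in R:\sigma(r)=r\ \forall\sigma\in\Sigma,\ \delta(r)=0\ \forall\delta\in\Delta\}$; for simple $R$ this is a field. $\Theta$ is the semigroup of maps $R\to R$ generated by $\Sigma\cup\Delta$ under composition, including the identity. *)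

(* Defs.v *)
From HB Require Import structures.
From mathcomp Require Import all_boot all_order all_algebra.
From mathcomp Require Import boolp classical_sets.

Set Implicit Arguments.
Unset Strict Implicit.
Unset Printing Implicit Defensive.

Import GRing.Theory.
Local Open Scope ring_scope.
Local Open Scope classical_set_scope.

(* Rings are [comPzRingType]s: the zero ring is allowed, and being nonzero is
   part of the definition of simplicity below. *)

Definition ring_automorphism (R : comPzRingType) (s : R -> R) : Prop :=
  [/\ zmod_morphism s, monoid_morphism s & bijective s].

Definition derivation (R : comPzRingType) (d : R -> R) : Prop :=
  zmod_morphism d /\ forall x y : R, d (x * y) = d x * y + x * d y.

(* A SigmaDelta-ring structure on [R]; [Sigma] and [Delta] are arbitrary,
   possibly empty or infinite. *)
Definition sd_ring (R : comPzRingType) (Sigma Delta : set (R -> R)) : Prop :=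
  [/\ (forall s, Sigma s -> ring_automorphism s),
      (forall d, Delta d -> derivation d)
    & forall mu tau, (Sigma `|` Delta) mu -> (Sigma `|` Delta) tau ->
        forall r : R, tau (mu r) = mu (tau r)].

(* MathComp's [idealr] only covers proper ideals with decidable membership. *)
Definition is_ideal (R : comPzRingType) (I : set R) : Prop :=
  [/\ I 0,
      (forall x y, I x -> I y -> I (x + y))
    & forall r x, I x -> I (r * x)].

Definition sd_ideal (R : comPzRingType) (Sigma Delta : set (R -> R))
    (I : set R) : Prop :=
  is_ideal I /\ forall tau, (Sigma `|` Delta) tau -> tau @` I `<=` I.

Definition simple_sd_ring (R : comPzRingType) (Sigma Delta : set (R -> R)) :
    Prop :=
  [/\ sd_ring Sigma Delta,
      (1 : R) != 0
    & forall I : set R, sd_ideal Sigma Delta I -> I = [set 0] \/ I = setT].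

Definition sd_constants (R : comPzRingType) (Sigma Delta : set (R -> R)) :
    set R :=
  [set r | (forall s, Sigma s -> s r = r) /\ (forall d, Delta d -> d r = 0)].

(* The monoid of maps generated by [Sigma `|` Delta]; inverses of elements of
   [Sigma] are not adjoined. *)
Inductive Theta (R : comPzRingType) (Sigma Delta : set (R -> R)) :
    (R -> R) -> Prop :=
| Theta_id : Theta Sigma Delta id
| Theta_gen tau : (Sigma `|` Delta) tau -> Theta Sigma Delta tau
| Theta_comp f g : Theta Sigma Delta f -> Theta Sigma Delta g ->
    Theta Sigma Delta (f \o g).

Definition linearly_dependent_over (R : comPzRingType) (K : set R) (m : nat)
    (a : 'I_m -> R) : Prop :=
  exists c : 'I_m -> R,
    [/\ (forall i, K (c i)), (exists i, c i != 0) & \sum_(i < m) c i * a i = 0].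

(* Main.v *)
Require Import Defs.
From HB Require Import structures.
From mathcomp Require Import all_boot all_order all_algebra.
From mathcomp Require Import boolp classical_sets.

(** Write [a] for the vector of the [a j] and call a tuple [b] a relation when
    [\sum_j b j * theta (a j) = 0] for every [theta] in [Theta].

    If [c] is a nonzero tuple of constants with [\sum_j c j * a j = 0], then [c]
    is a relation, because the maps in [Theta] are linear over the constants.
    Each matrix [(theta i (a j))] therefore kills [c], and Cramer's rule gives
    [\det _ * c j = 0].  The annihilator of a constant is a
    [Sigma Delta]-ideal, so by simplicity a nonzero constant is not a zero
    divisor and the determinant vanishes ([constant_regular]).

    Conversely, argue by induction on the length of [a].  Call the elements
    [\det (theta i (a j))] the Theta-determinants of [a].  The ideal which they
    generate is stable: an automorphism sends a determinant to another one, and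
    a derivation acts row by row ([derivation_det]).  So as soon as one of them
    is nonzero, they generate the unit ideal ([thetadet_unit_ideal]).  Suppose
    that the Theta-determinants of [a] vanish.  If those of the tail of [a]
    vanish too, the induction hypothesis applies to the tail.  Otherwise they
    generate the unit ideal.  Expanding a vanishing determinant along its first
    row turns each of them into a relation on [a] with that
    determinant as first coefficient, so a linear combination gives a
    relation [b] with [b ord0 = 1] ([normalized_relation]).  Such a [b] consists
    of constants ([normalized_relation_constant]): applying [d] in [Delta],
    or applying [s] in [Sigma] and subtracting, cancels the first coefficient
    and leaves a relation on the tail of [a], whose coefficients are killed by
    determinants that generate the unit ideal, hence are zero.

    [R] may have zero divisors and nilpotent elements, so no step divides by a
    determinant: the unit ideal takes the place of a nonzero minor. *)

Set Implicit Arguments.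
Unset Strict Implicit.
Unset Printing Implicit Defensive.

Import GRing.Theory.
Local Open Scope ring_scope.
Local Open Scope classical_set_scope.

(** * Automorphisms, derivations and determinants *)

Section AdditiveMaps.
Variables (V W : zmodType) (f : V -> W).
Hypothesis f_sub : zmod_morphism f.

Lemma zmod_morphism0 : f 0 = 0.
Proof. by rewrite -[X in f X](subrr 0) f_sub subrr. Qed.

Lemma zmod_morphismN x : f (- x) = - f x.
Proof. by rewrite -sub0r f_sub zmod_morphism0 sub0r. Qed.

Lemma zmod_morphismD x y : f (x + y) = f x + f y.
Proof. by rewrite -[y in LHS]opprK f_sub zmod_morphismN opprK. Qed.

Lemma zmod_morphism_sum (I : Type) (r : seq I) (P : pred I) (F : I -> V) :
  f (\sum_(i <- r | P i) F i) = \sum_(i <- r | P i) f (F i).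
Proof. exact: (big_morph f zmod_morphismD zmod_morphism0). Qed.

End AdditiveMaps.

Section Determinants.
Variable R : comPzRingType.

Lemma derivation1 (d : R -> R) : derivation d -> d 1 = 0.
Proof.
case=> _ dM; have := dM 1 1; rewrite !mulr1 mul1r => /eqP.
by rewrite -subr_eq subrr eq_sym => /eqP.
Qed.

Lemma derivation_prod (d : R -> R) n (F : 'I_n -> R) : derivation d ->
  d (\prod_i F i) = \sum_i \prod_k (if k == i then d (F k) else F k).
Proof.
move=> dd; have [_ dM] := dd; elim: n F => [|n IHn] F.
  by rewrite !big_ord0 derivation1.
rewrite !big_ord_recl dM IHn eqxx; congr (_ + _).
rewrite mulr_sumr; apply: eq_bigr => i _.
rewrite [RHS]big_ord_recl (negPf (neq_lift _ _)); congr (_ * _).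
Qed.

Lemma derivation_det (d : R -> R) n (A : 'M[R]_n) : derivation d ->
  d (\det A) =
  \sum_i \det (\matrix_(k, j) if k == i then d (A k j) else A k j).
Proof.
move=> dd; have [dB _] := dd.
rewrite /determinant (zmod_morphism_sum dB) exchange_big /=.
apply: eq_bigr => s _; rewrite -mulr_sumr.
have d_sign (e : bool) x : d ((-1) ^+ e * x) = (-1) ^+ e * d x.
  by case: e; rewrite ?mul1r // !mulN1r (zmod_morphismN dB).
rewrite d_sign derivation_prod //; congr (_ * _); apply: eq_bigr => i _.
by apply: eq_bigr => k _; rewrite mxE.
Qed.

Lemma automorphism_det (s : R -> R) n (A : 'M[R]_n) : ring_automorphism s ->
  s (\det A) = \det (map_mx s A).
Proof.
case=> sB sM _.
pose s' : {rmorphism R -> R} := HB.pack s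
  (GRing.isZmodMorphism.Build R R s sB) (GRing.isMonoidMorphism.Build R R s sM).
by rewrite -[s]/(s' : R -> R) det_map_mx.
Qed.

(** Cramer's rule, as a statement on the kernel of a matrix that need not be
    invertible. *)
Lemma det_annihilates_kernel n (A : 'M[R]_n) (c : 'I_n -> R) :
  (forall i, \sum_j c j * A i j = 0) -> forall j, \det A * c j = 0.
Proof.
move=> Ac0 j; pose v : 'cV[R]_n := \col_k c k.
have Av0 : A *m v = 0.
  apply/matrixP => i k; rewrite !mxE -[RHS](Ac0 i).
  by apply: eq_bigr => l _; rewrite mxE mulrC.
have := mul_adj_mx A => /(congr1 (fun B => (B *m v) j ord0)).
by rewrite -mulmxA Av0 mulmx0 mul_scalar_mx !mxE.
Qed.

End Determinants.

(** * Theta-determinants and relations *)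

Section Theta.
Variables (R : comPzRingType) (Sigma Delta : set (R -> R)).
Hypothesis hR : simple_sd_ring Sigma Delta.

Let sigma_auto s : Sigma s -> ring_automorphism s.
Proof. by case: hR => [[+ _ _] _ _]; exact. Qed.

Let delta_der d : Delta d -> derivation d.
Proof. by case: hR => [[_ + _] _ _]; exact. Qed.

Lemma Theta_sub theta : Theta Sigma Delta theta -> zmod_morphism theta.
Proof.
elim=> [//|tau [/sigma_auto[]//|/delta_der[]//]|f g _ fB _ gB x y].
by rewrite /= gB fB.
Qed.

Lemma Theta_constantM theta c x : Theta Sigma Delta theta ->
  sd_constants Sigma Delta c -> theta (c * x) = c * theta x.
Proof.
move=> th [cS cD]; elim: th x => [//|tau [St|Dt] x|f g _ IHf _ IHg x].
- by have [_ [_ sM] _] := sigma_auto St; rewrite sM cS.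
- by have [_ ->] := delta_der Dt; rewrite cD // mul0r add0r.
- by rewrite /= IHg IHf.
Qed.

(** The annihilator of [c] is stable under [Sigma] and [Delta] because these maps
    commute with multiplication by [c]; it is not all of [R], since [c != 0]. *)
Lemma constant_regular c x :
  sd_constants Sigma Delta c -> c != 0 -> x * c = 0 -> x = 0.
Proof.
move=> cK c0 xc0; have [_ _ simpleR] := hR.
have [|annE|annE] := simpleR [set r | r * c = 0].
- split; first split=> /= [|r1 r2 r10 r20|r1 r2 r20].
  + by rewrite mul0r.
  + by rewrite mulrDl r10 r20 addr0.
  + by rewrite -mulrA r20 mulr0.
- move=> tau tauG _ [r /= rc0 <-].
  have th := Theta_gen tauG.
  by rewrite mulrC -Theta_constantM // mulrC rc0 (zmod_morphism0 (Theta_sub th)).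
- by have : [set r | r * c = 0] x by []; rewrite annE.
- have : [set r | r * c = 0] 1 by rewrite annE.
  by rewrite /= mul1r => c00; rewrite c00 eqxx in c0.
Qed.

Definition theta_mx m (theta : 'I_m -> R -> R) (a : 'I_m -> R) : 'M[R]_m :=
  \matrix_(i, j) theta i (a j).

Definition thetadet m (a : 'I_m -> R) : set R :=
  [set r | exists2 theta : 'I_m -> R -> R,
     forall i, Theta Sigma Delta (theta i) & r = \det (theta_mx theta a)].

Definition theta_relation m (a b : 'I_m -> R) : Prop :=
  forall theta, Theta Sigma Delta theta -> \sum_j b j * theta (a j) = 0.

Lemma thetadet_automorphism m (a : 'I_m -> R) s r :
  Sigma s -> thetadet a r -> thetadet a (s r).
Proof.
move=> Ss [theta thetaP ->]; exists (fun i => s \o theta i).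
  by move=> i; apply: Theta_comp => //; apply: Theta_gen; left.
rewrite automorphism_det; last exact: sigma_auto.
by congr (\det _); apply/matrixP => i j; rewrite !mxE.
Qed.

Lemma thetadet_derivation m (a : 'I_m -> R) d r : Delta d -> thetadet a r ->
  exists F : 'I_m -> R, (forall i, thetadet a (F i)) /\ d r = \sum_i F i.
Proof.
move=> Dd [theta thetaP ->].
pose th i k := if k == i then d \o theta k else theta k.
exists (fun i => \det (theta_mx (th i) a)); split=> [i|].
  exists (th i) => // k; rewrite /th; case: eqP => // _.
  by apply: Theta_comp => //; apply: Theta_gen; right.
rewrite derivation_det; last exact: delta_der.
apply: eq_bigr => i _; congr (\det _); apply/matrixP => k j.
by rewrite !mxE /th; case: eqP.
Qed.

(** The ideal generated by the determinants is taken as the intersection of the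
    ideals [J] that contain them.  Its stability then follows without any
    linear combinations: for [tau] in [Sigma] or [Delta], the [r] such that both
    [r] and [tau r] lie in the intersection form an ideal containing the
    determinants. *)
Lemma thetadet_unit_ideal m (a : 'I_m -> R) r0 (J : set R) :
  thetadet a r0 -> r0 != 0 -> is_ideal J -> thetadet a `<=` J -> J 1.
Proof.
move=> ar0 r0N0 Jid aJ; have [_ _ simpleR] := hR.
pose I := [set r : R | forall J, is_ideal J -> thetadet a `<=` J -> J r].
have aI : thetadet a `<=` I by move=> r ar K _; apply.
have [I0 ID IM] : is_ideal I.
  split=> [K [K0 _ _] _ //|x y Ix Iy K Kid aK|r x Ix K Kid aK].
  - by have [_ KD _] := Kid; apply: KD; [apply: Ix|apply: Iy].
  - by have [_ _ KM] := Kid; apply: KM; apply: Ix.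
have Isum n (F : 'I_n -> R) : (forall i, I (F i)) -> I (\sum_i F i).
  by move=> IF; elim/big_ind: _.
have Istable tau : (Sigma `|` Delta) tau -> tau @` I `<=` I.
  move=> tauG _ [r Ir <-].
  have tauB := Theta_sub (Theta_gen tauG).
  suff [] : [set r | I r /\ I (tau r)] r by [].
  apply: Ir => [|x ax].
    split=> [|x y [Ix Itx] [Iy Ity]|y x [Ix Itx]].
    - by split=> //; rewrite (zmod_morphism0 tauB).
    - by split; rewrite ?(zmod_morphismD tauB); apply: ID.
    - split; first exact: IM.
      case: tauG => [/sigma_auto[_ [_ tauM] _]|/delta_der[_ tauM]].
        by rewrite tauM; apply: IM.
      by rewrite tauM; apply: ID; apply: IM.
  split; first exact: aI.
  case: tauG => [St|Dt]; first by apply: aI; apply: thetadet_automorphism.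
  have [F [aF ->]] := thetadet_derivation Dt ax.
  by apply: Isum => i; apply: aI.
have [//|IE|IE] := simpleR I.
  by have := aI _ ar0; rewrite IE /= => r00; rewrite r00 eqxx in r0N0.
suff : I 1 by apply.
by rewrite IE.
Qed.

(** The coefficients are the signed minors of the [m] by [m.+1] matrix with rows
    [theta i (a _)]: [\sum_j b j * t (a j)] is then the expansion along the
    first row of the determinant obtained by adding the row [t (a _)] on top. *)
Lemma minor_relation m (a : 'I_m.+1 -> R) r :
  (forall theta, (forall i, Theta Sigma Delta (theta i)) ->
     \det (theta_mx theta a) = 0) ->
  thetadet (fun k => a (lift ord0 k)) r ->
  exists2 b, b ord0 = r & theta_relation a b.
Proof.
move=> a_det0 [theta thetaP ->].
pose M j : 'M[R]_m := \matrix_(i, k) theta i (a (lift j k)).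
exists (fun j : 'I_m.+1 => (-1) ^+ j * \det (M j)); first by rewrite expr0 mul1r.
move=> t tP; pose th i := if unlift ord0 i is Some k then theta k else t.
rewrite -[RHS](a_det0 th); last by move=> i; rewrite /th; case: unliftP.
rewrite (expand_det_row _ ord0); apply: eq_bigr => j _.
rewrite mulrC mxE /th unlift_none; congr (_ * _).
rewrite /cofactor add0n; congr (_ * \det _).
by apply/matrixP => i k; rewrite !mxE liftK.
Qed.

Lemma normalized_relation m (a : 'I_m.+1 -> R) r0 :
  (forall theta, (forall i, Theta Sigma Delta (theta i)) ->
     \det (theta_mx theta a) = 0) ->
  thetadet (fun k => a (lift ord0 k)) r0 -> r0 != 0 ->
  exists2 b, b ord0 = 1 & theta_relation a b.
Proof.
move=> a_det0 ar0 r0N0.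
pose J := [set r | exists2 b, b ord0 = r & theta_relation a b].
apply: (thetadet_unit_ideal (J := J) ar0 r0N0) => [|r]; last first.
  exact: minor_relation.
split=> [|x y [b bx ba] [c cy ca]|r x [b bx ba]].
- by exists (fun=> 0) => // t _; rewrite big1 // => j _; rewrite mul0r.
- exists (fun j => b j + c j); first by rewrite bx cy.
  move=> t tP; under eq_bigr do rewrite mulrDl.
  by rewrite big_split /= ba // ca // addr0.
- exists (fun j => r * b j); first by rewrite bx.
  move=> t tP; under eq_bigr do rewrite -mulrA.
  by rewrite -mulr_sumr ba // mulr0.
Qed.

Lemma relation_thetadet m (a c : 'I_m -> R) r j :
  theta_relation a c -> thetadet a r -> r * c j = 0.
Proof.
move=> ac [theta thetaP ->]; apply: det_annihilates_kernel => i.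
by under eq_bigr do rewrite mxE; exact: ac.
Qed.

Lemma normalized_relation_constant m (a b : 'I_m.+1 -> R) r0 :
  thetadet (fun k => a (lift ord0 k)) r0 -> r0 != 0 ->
  b ord0 = 1 -> theta_relation a b ->
  forall j, sd_constants Sigma Delta (b j).
Proof.
move=> ar0 r0N0 b0 ba j; split=> [s Ss|d Dd].
  have [sB [s1 sM] _] := sigma_auto Ss.
  case: (unliftP ord0 j) => [k ->|->]; last by rewrite b0.
  pose c k := s (b (lift ord0 k)) - b (lift ord0 k).
  (* Applying [s] only yields the identity for the maps [s \o t], hence the
     twisted ideal of the [r] with [s r * c k = 0] below. *)
  have ca t : Theta Sigma Delta t ->
      \sum_k c k * s (t (a (lift ord0 k))) = 0.
    move=> tP; have := congr1 s (ba t tP).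
    have stP : Theta Sigma Delta (s \o t).
      by apply: Theta_comp => //; apply: Theta_gen; left.
    rewrite (zmod_morphism0 sB) (zmod_morphism_sum sB) -[RHS](ba _ stP) => /eqP.
    rewrite !big_ord_recl b0 sM s1 /= => /eqP/addrI/eqP.
    rewrite -subr_eq0 -sumrB => /eqP sum0; rewrite -[RHS]sum0.
    by apply: eq_bigr => i _; rewrite sM mulrBl.
  suff : [set r | s r * c k = 0] 1.
    by rewrite /= s1 mul1r => /eqP; rewrite subr_eq0 => /eqP.
  apply: (thetadet_unit_ideal ar0 r0N0) => [|_ [theta thetaP ->] /=].
    split=> /= [|x y x0 y0|r x x0].
    - by rewrite (zmod_morphism0 sB) mul0r.
    - by rewrite (zmod_morphismD sB) mulrDl x0 y0 addr0.
    - by rewrite sM -mulrA x0 mulr0.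
  rewrite (automorphism_det _ (sigma_auto Ss)).
  apply: det_annihilates_kernel => i.
  by under eq_bigr do rewrite !mxE; exact: ca.
have [dB dM] := delta_der Dd.
case: (unliftP ord0 j) => [k ->|->]; last first.
  by rewrite b0 derivation1 //; exact: delta_der.
pose c k := d (b (lift ord0 k)).
have ca : theta_relation (fun k => a (lift ord0 k)) c.
  move=> t tP; have := congr1 d (ba t tP).
  have dtP : Theta Sigma Delta (d \o t).
    by apply: Theta_comp => //; apply: Theta_gen; right.
  rewrite (zmod_morphism0 dB) (zmod_morphism_sum dB).
  under eq_bigr do rewrite dM.
  rewrite big_split /= (ba _ dtP) addr0 big_ord_recl b0.
  by rewrite (derivation1 (delta_der Dd)) mul0r add0r.
suff : [set r | r * c k = 0] 1 by rewrite /= mul1r.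
apply: (thetadet_unit_ideal ar0 r0N0) => [|r ar /=].
  split=> /= [|x y x0 y0|r x x0].
  - by rewrite mul0r.
  - by rewrite mulrDl x0 y0 addr0.
  - by rewrite -mulrA x0 mulr0.
exact: relation_thetadet ca ar.
Qed.

(** * The two implications *)

Lemma dependent_det0 m (a : 'I_m -> R) theta :
  linearly_dependent_over (sd_constants Sigma Delta) a ->
  (forall i, Theta Sigma Delta (theta i)) -> \det (theta_mx theta a) = 0.
Proof.
move=> [c [cK [i0 ci0] ca0]] thetaP.
apply: (constant_regular (cK i0) ci0); apply: relation_thetadet.
  2: by exists theta.
move=> t tP; have tB := Theta_sub tP.
rewrite -[RHS](zmod_morphism0 tB) -[X in _ = t X]ca0 (zmod_morphism_sum tB).
by apply: eq_bigr => j _; rewrite Theta_constantM.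
Qed.

Lemma dependent_extend m (a : 'I_m.+1 -> R) :
  linearly_dependent_over (sd_constants Sigma Delta)
    (fun k => a (lift ord0 k)) ->
  linearly_dependent_over (sd_constants Sigma Delta) a.
Proof.
move=> [c [cK [i ci] ca0]].
exists (fun j => if unlift ord0 j is Some k then c k else 0); split.
- move=> j; case: unliftP => [k _|_]; first exact: cK.
  split=> [s /sigma_auto[sB _ _]|d /delta_der[dB _]].
    exact: zmod_morphism0 sB.
  exact: zmod_morphism0 dB.
- by exists (lift ord0 i); rewrite liftK.
- rewrite big_ord_recl unlift_none mul0r add0r -[RHS]ca0.
  by apply: eq_bigr => k _; rewrite liftK.
Qed.

Lemma det0_dependent m (a : 'I_m -> R) :
  (forall theta, (forall i, Theta Sigma Delta (theta i)) ->
     \det (theta_mx theta a) = 0) ->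
  linearly_dependent_over (sd_constants Sigma Delta) a.
Proof.
have [_ R1 _] := hR; elim: m a => [|m IHm] a a_det0.
  (* The empty family is independent, but its only determinant is 1. *)
  have := a_det0 (fun=> id) (fun=> Theta_id _ _).
  by rewrite det_mx00 => /eqP; rewrite (negPf R1).
have [tail0|] := pselect
    (thetadet (fun k => a (lift ord0 k)) `<=` [set 0]).
  by apply: dependent_extend; apply: IHm => th thP; apply: tail0; exists th.
move=> /existsNP[r0] /not_implyP[ar0 /eqP r0N0].
have [b b0 ba] := normalized_relation a_det0 ar0 r0N0.
exists b; split.
- exact: normalized_relation_constant ar0 r0N0 b0 ba.
- by exists ord0; rewrite b0.
- exact: ba id (Theta_id _ _).
Qed.

End Theta.

Theorem proposition3p3 (R : comPzRingType) (Sigma Delta : set (R -> R))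
    (hR : simple_sd_ring Sigma Delta) (m : nat) (a : 'I_m -> R) :
  linearly_dependent_over (sd_constants Sigma Delta) a <->
  (forall theta : 'I_m -> R -> R,
     (forall i, Theta Sigma Delta (theta i)) ->
     \det (\matrix_(i < m, j < m) theta i (a j)) = 0).
Proof.
split=> [adep theta thetaP|]; last exact: det0_dependent hR m a.
exact: (dependent_det0 hR adep thetaP).
Qed.
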